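(* Let $X$ be a (real) Banach space with an unconditional, bidemocratic basis $(e_i)_{i\in\mathbb N}$. Then for every $\varepsilon>0$ there is an equivalent norm on $X$ with respect to which $(e_i)$ is $1$-unconditional, $1$-bidemocratic and $(1+\varepsilon)$-greedy.
   Context: $\mathbb N=\{1,2,\dots\}$. Bases are Schauder bases indexed by $\mathbb N$ and are assumed seminormalized: $0<\inf_i\|e_i\|\le\sup_i\|e_i\|<\infty$. Let $(e_i^* )$ be the biorthogonal functionals in $X^*$. The basis $(e_i)$ is $K$-unconditional if $\|\sum a_ie_i\|\le K\|\sum b_ie_i\|$ whenever $|a_i|\le|b_i|$ for all $i$; it is unconditional if it is $K$-unconditional for some $K$. The fundamental function of $(e_i)$ is $\varphi(n)=\sup_{|A|\le n}\|\sum_{i\in A}e_i\|$, and the dual fundamental function is $\varphi^*(n)=\sup_{|A|\le n}\|\sum_{i\in A}e_i^*\|$ (dual norm), $n\in\mathbb N$, where $A$ ranges over finite subsets of $\mathbb N$. The basis is $\Delta$-bidemocratic (for $\Delta\ge1$) if $\varphi(n)\varphi^*(n)\le\Delta n$ for all $n\in\mathbb N$, and bidemocratic if it is $\Delta$-bidemocratic for some $\Delta$. For $x=\sum x_ie_i\in X$ and $m\in\mathbb N$ put $\sigma_m(x)=\inf\{\|x-\sum_{i\in A}a_ie_i\|: A\subset\mathbb N,\ |A|\le m,\ (a_i)_{i\in A}\subset\mathbb R\}$. For each $x$ fix distinct indices $\rho(1),\rho(2),\dots$ (depending on $x$, not necessarily unique) such that $|x_{\rho(1)}|\ge|x_{\rho(2)}|\ge\cdots$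 and, for every $m$, $|x_{\rho(m)}|\ge|x_i|$ for all $i\notin\{\rho(1),\dots,\rho(m)\}$; the $m$-th greedy approximant is $\mathcal G_m(x)=\sum_{i=1}^m x_{\rho(i)}e_{\rho(i)}$. The basis is $C$-greedy if $\|x-\mathcal G_m(x)\|\le C\sigma_m(x)$ for all $x\in X$ and all $m\in\mathbb N$. When the space is renormed, all these notions are computed with respect to the new norm (and its dual norm). *)

(* Defs.v *)
From HB Require Import structures.
From mathcomp Require Import all_boot all_order all_algebra finmap.
From mathcomp Require Import all_classical all_reals all_analysis.

Set Implicit Arguments.
Unset Strict Implicit.
Unset Printing Implicit Defensive.

Import Order.TTheory GRing.Theory Num.Theory.
Import numFieldNormedType.Exports.

Local Open Scope classical_set_scope.
Local Open Scope ring_scope.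

(* Bases are indexed from 0, i.e. [e n] stands for e_{n+1}.  Every notion that
   depends on the norm takes the norm [N : X -> R] as an argument, so that it
   can be computed both for the given norm [Num.norm] and for a renorming.
   Convergence of expansions always refers to the topology of [X], which all
   equivalent norms induce. *)

Definition expansion (R : realType) (X : normedModType R) (e : nat -> X)
    (a : nat -> R) (x : X) : Prop :=
  series (fun i => a i *: e i) @ \oo --> x.

Definition schauder_basis (R : realType) (X : normedModType R)
    (e : nat -> X) : Prop :=
  forall x : X, exists! a : nat -> R, expansion e a x.

Definition seminormalized (R : realType) (X : lmodType R) (N : X -> R)
    (e : nat -> X) : Prop :=
  exists c C : R, 0 < c /\ forall i, c <= N (e i) /\ N (e i) <= C.

(* [coord e i] is the biorthogonal functional e_i^*, and [coord e i x] the
   coefficient x_i of [x]; the default value is never used when [e] is a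
   Schauder basis. *)
Definition coord (R : realType) (X : normedModType R) (e : nat -> X)
    (i : nat) (x : X) : R :=
  xget (fun=> 0) [set a | expansion e a x] i.

Definition is_norm (R : realType) (X : lmodType R) (N : X -> R) : Prop :=
  [/\ forall x y, N (x + y) <= N x + N y,
      forall (a : R) x, N (a *: x) = `|a| * N x &
      forall x, N x = 0 -> x = 0].

Definition equivalent_norm (R : realType) (X : normedModType R)
    (N : X -> R) : Prop :=
  is_norm N /\
  exists c C : R, [/\ 0 < c, 0 < C & forall x, c * `|x| <= N x <= C * `|x|].

Definition K_unconditional (R : realType) (X : normedModType R) (N : X -> R)
    (e : nat -> X) (K : R) : Prop :=
  forall (a b : nat -> R) (x y : X), expansion e a x -> expansion e b y ->
    (forall i, `|a i| <= `|b i|) -> N x <= K * N y.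

Definition unconditional (R : realType) (X : normedModType R) (N : X -> R)
    (e : nat -> X) : Prop :=
  exists K : R, K_unconditional N e K.

(* The suprema below are taken in [\bar R], where they always exist. *)
Definition dual_norm (R : realType) (X : lmodType R) (N : X -> R)
    (f : X -> R) : \bar R :=
  ereal_sup [set (`|f x|)%:E | x in [set x | N x <= 1]].

Definition fundamental (R : realType) (X : lmodType R) (N : X -> R)
    (e : nat -> X) (n : nat) : \bar R :=
  ereal_sup [set (N (\sum_(i <- A) e i))%:E
            | A in [set A : {fset nat} | (#|` A| <= n)%N]].

Definition dual_fundamental (R : realType) (X : normedModType R) (N : X -> R)
    (e : nat -> X) (n : nat) : \bar R :=
  ereal_sup [set dual_norm N (fun x => \sum_(i <- A) coord e i x)
            | A in [set A : {fset nat} | (#|` A| <= n)%N]].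

Definition D_bidemocratic (R : realType) (X : normedModType R) (N : X -> R)
    (e : nat -> X) (D : R) : Prop :=
  forall n : nat, (0 < n)%N ->
    (fundamental N e n * dual_fundamental N e n <= (D * n%:R)%:E)%E.

Definition bidemocratic (R : realType) (X : normedModType R) (N : X -> R)
    (e : nat -> X) : Prop :=
  exists D : R, 1 <= D /\ D_bidemocratic N e D.

Definition sigma_term (R : realType) (X : lmodType R) (N : X -> R)
    (e : nat -> X) (m : nat) (x : X) : R :=
  inf [set t : R | exists (A : {fset nat}) (a : nat -> R),
         (#|` A| <= m)%N /\ t = N (x - \sum_(i <- A) a i *: e i)].

(* With 0-based indexing, [r k] is rho(k+1). *)
Definition greedy_ordering (R : realType) (X : normedModType R) (e : nat -> X)
    (x : X) (r : nat -> nat) : Prop :=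
  [/\ injective r,
      forall k, `|coord e (r k.+1) x| <= `|coord e (r k) x| &
      forall m i, (forall k, (k <= m)%N -> i <> r k) ->
        `|coord e i x| <= `|coord e (r m) x|].

Definition greedy_approximant (R : realType) (X : normedModType R)
    (e : nat -> X) (r : nat -> nat) (m : nat) (x : X) : X :=
  \sum_(k < m) coord e (r k) x *: e (r k).

(* [rho x] is the greedy ordering fixed for [x]. *)
Definition C_greedy (R : realType) (X : normedModType R) (N : X -> R)
    (e : nat -> X) (rho : X -> nat -> nat) (C : R) : Prop :=
  forall (x : X) (m : nat), (0 < m)%N ->
    N (x - greedy_approximant e (rho x) m x) <= C * sigma_term N e m x.

(* Main.v *)
Require Import Defs.
From HB Require Import structures.
From mathcomp Require Import all_boot all_order all_algebra finmap.
From mathcomp Require Import all_classical all_reals all_analysis.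
From mathcomp Require Import ring zify.
Import Order.TTheory GRing.Theory Num.Theory.
Import numFieldNormedType.Exports.
Local Open Scope classical_set_scope.
Local Open Scope ring_scope.

(** Let [phi] be the fundamental function of the basis computed with arbitrary
coefficients of modulus at most 1, so [phi n] is the supremum of the
norms of [\sum_(i <- A) a i *: e i] with [#|A| <= n] and [|a i| <= 1].  Averaging over
the subsets obtained by removing one index shows that [phi n / n] is
nonincreasing ([phi_div_antitone]).  Consider

  [U x] = the supremum of [|\sum_(i <- A) lam i * x_i *: e i|] over finite [A]
          and multipliers [|lam i| <= 1],
  [M x] = the supremum of [phi #|E| / #|E| * \sum_(i <- E) |x_i|] over finite [E],

and the norm [N = max U M + eps^-1 * M].

- [N] is an equivalent norm: unconditionality bounds [U], and bidemocracy bounds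
  [M], since it says that the functional [phi #|E| / #|E| * \sum_(i <- E) e_i^*]
  has bounded dual norm ([average_seminorm_le]).  Both suprema depend
  monotonically on the moduli of the coordinates, so the basis becomes
  1-unconditional.

- Since [phi n / n] is nonincreasing, [max U M] and [M] are both at most
  [phi #|A|] at the sum of the basis vectors in [A], whereas they are both at
  least [phi #|A| / #|A| * \sum_(i <- A) |x_i|] at any [x].  Hence the new
  fundamental function is at most [(1 + eps^-1) * phi n] and the dual one at most
  [n / ((1 + eps^-1) * phi n)], whose product is [n]: the basis is
  1-bidemocratic.

- Let [G] be the set of a greedy approximant of [x], [t] the least modulus of a
  coordinate of [x] in [G], [x'] the part of [x] off [G], and [y] the difference
  of [x] and a combination supported in [A], with [#|A| <= #|G|].  As [M] only
  sees the decreasing rearrangement, trading the coordinates of [x] in [A \ G],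
  at most [t], for those in [G \ A], at least [t], gives [M x' <= M y].  For
  [max U M] it is enough to be crude: the part of [x'] in [A \ G] contributes at
  most [t * phi #|G \ A|], which is at most [M y].  So [N x' <= N y + M y], and
  [M y <= eps * N y] because of the weight [eps^-1]: this is
  [(1 + eps)]-greediness.
*)

(* The import of the algebra library hides the coefficient functionals behind
   the coordinates of finite-dimensional vector spaces. *)
Local Notation coord := Defs.coord.

(** * Sums over finite sets of indices *)

Lemma sum_fset_const {V : nmodType} (A : {fset nat}) (t : V) :
  \sum_(i <- A) t = t *+ #|` A|.
Proof. by rewrite big_const_seq count_predT iter_addr addr0. Qed.

Lemma sum_seq_fset {V : nmodType} (s : seq nat) (F : nat -> V) :
  uniq s -> \sum_(i <- seq_fset tt s) F i = \sum_(i <- s) F i.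
Proof.
by move=> us; apply: perm_big; rewrite -[s in perm_eq _ s](undup_id us) seq_fset_perm.
Qed.

Lemma sum_fsetID {V : nmodType} (A E : {fset nat}) (F : nat -> V) :
  \sum_(i <- A) F i = \sum_(i <- (A `&` E)%fset) F i + \sum_(i <- (A `\` E)%fset) F i.
Proof.
rewrite (big_fsetID _ (mem E)); congr (_ + _); apply: eq_fbigl => i; rewrite !inE//.
by rewrite andbC.
Qed.

Lemma sum_fsetU {V : nmodType} (A E : {fset nat}) (F : nat -> V) :
  [disjoint A & E]%fset ->
  \sum_(i <- (A `|` E)%fset) F i = \sum_(i <- A) F i + \sum_(i <- E) F i.
Proof.
move=> dis; rewrite (sum_fsetID _ E) addrC; congr (_ + _); apply: eq_fbigl => i.
  rewrite !inE; case: (boolP (i \in A)) => [/(fdisjointP dis) ->//|_].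
  by rewrite andNb.
by rewrite !inE andb_orl andbb; case: (i \in E); rewrite ?orbT ?andbF.
Qed.

Lemma exists_subset_card (A : {fset nat}) n : (n <= #|` A|)%N ->
  exists2 A' : {fset nat}, (A' `<=` A)%fset & #|` A'| = n.
Proof.
move=> nA; exists (seq_fset tt (take n A)).
  by apply/fsubsetP => i; rewrite seq_fsetE => /mem_take.
by rewrite size_seq_fset undup_id ?take_uniq ?fset_uniq// size_takel.
Qed.

Lemma card_fsetD_exchange {A G : {fset nat}} : (#|` A| <= #|` G|)%N ->
  (#|` (A `\` G)%fset| <= #|` (G `\` A)%fset|)%N.
Proof. by have := cardfsID G A; have := cardfsID A G; rewrite fsetIC; lia. Qed.

(** * Coefficient functionals of a Schauder basis *)

Section Coordinates.
Context {R : realType} {X : normedModType R} {e : nat -> X}.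
Hypothesis he : schauder_basis e.

Lemma expansion_coord x : expansion e (coord e ^~ x) x.
Proof.
have [a [ha _]] := he x.
by rewrite /coord; apply: (@xgetPex _ (fun=> 0) [set b | expansion e b x]); exists a.
Qed.

Lemma coord_expansion a x : expansion e a x -> forall i, coord e i x = a i.
Proof.
move=> hax i; have [b [_ ub]] := he x.
by rewrite -(ub _ hax) (ub _ (expansion_coord x)).
Qed.

Lemma coordD i x y : coord e i (x + y) = coord e i x + coord e i y.
Proof.
apply: (@coord_expansion (fun i => coord e i x + coord e i y)).
rewrite /expansion (_ : series _ =
  series (fun i => coord e i x *: e i) + series (fun i => coord e i y *: e i)).
  by apply: cvgD; exact: expansion_coord.
rewrite -seriesD; congr series; apply/funext => j.
by rewrite fctE scalerDl.
Qed.

Lemma coordZ i (a : R) x : coord e i (a *: x) = a * coord e i x.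
Proof.
apply: (@coord_expansion (fun i => a * coord e i x)).
rewrite /expansion (_ : series _ = a \*: series (fun i => coord e i x *: e i)).
  by apply: cvgZl_tmp; exact: expansion_coord.
apply/funext => n; rewrite /series /= scaler_sumr.
by apply: eq_bigr => j _; rewrite scalerA.
Qed.

Lemma coordB i x y : coord e i (x - y) = coord e i x - coord e i y.
Proof. by rewrite -scaleN1r coordD coordZ mulN1r. Qed.

Lemma coord_zero i : coord e i 0 = 0.
Proof. by rewrite -[0 in LHS](subrr 0) coordB subrr. Qed.

(** The partial sums are eventually constant. *)
Lemma expansion_fsum (A : {fset nat}) (a : nat -> R) :
  expansion e (fun i => if i \in A then a i else 0) (\sum_(i <- A) a i *: e i).
Proof.
apply: cvg_near_cst; exists (\max_(i <- A) i).+1 => // n /= An.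
rewrite /series /= (eq_bigr (fun i => if i \in A then a i *: e i else 0)); last first.
  by move=> i _; case: ifP; rewrite ?scale0r.
rewrite -big_mkcond /= -big_filter; apply: perm_big.
apply: uniq_perm; rewrite ?filter_uniq ?iota_uniq ?fset_uniq// => i.
rewrite mem_filter mem_index_iota /=; case: (boolP (i \in A)) => //= iA.
by apply: leq_trans An; rewrite ltnS; exact: leq_bigmax_seq.
Qed.

Lemma coord_fsum i (A : {fset nat}) (a : nat -> R) :
  coord e i (\sum_(j <- A) a j *: e j) = if i \in A then a i else 0.
Proof. exact: (coord_expansion _ _ (expansion_fsum A a)). Qed.

Lemma coord_inj x y : (forall i, coord e i x = coord e i y) -> x = y.
Proof.
move=> xy; have := expansion_coord y.
rewrite (_ : coord e ^~ y = coord e ^~ x); last by apply/funext => i; rewrite xy.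
exact: (cvg_unique _ (expansion_coord x)).
Qed.

End Coordinates.

(** * Suprema of uniformly bounded families of seminorms *)

Section SupSeminorm.
Context {R : realType} {X : normedModType R}.
Implicit Types (p : X -> R) (S : set (X -> R)).

Definition bounded_seminorm (C : R) p : Prop :=
  [/\ forall x y, p (x + y) <= p x + p y,
      forall (a : R) x, p (a *: x) = `|a| * p x &
      forall x, p x <= C * `|x|].

Definition sup_seminorm S (x : X) : R := sup [set p x | p in S].

Context {S : set (X -> R)} {C : R}.
Hypotheses (S0 : S !=set0) (SC : forall p, S p -> bounded_seminorm C p).

Lemma sup_seminorm_ge p x : S p -> p x <= sup_seminorm S x.
Proof.
move=> Sp; apply: ub_le_sup; last by exists p.
by exists (C * `|x|) => _ [q /SC[_ _ +] <-]; exact.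
Qed.

Lemma sup_seminorm_le x t : (forall p, S p -> p x <= t) -> sup_seminorm S x <= t.
Proof.
move=> h; apply: ge_sup; last by move=> _ [p Sp <-]; exact: h.
by have [p Sp] := S0; exists (p x), p.
Qed.

Lemma sup_seminorm_bounded : bounded_seminorm C (sup_seminorm S).
Proof.
split.
- move=> x y; apply: sup_seminorm_le => p Sp; have [pD _ _] := SC _ Sp.
  by apply: le_trans (pD x y) _; rewrite lerD// sup_seminorm_ge.
- (* The opposite inequality is this one for the inverse scalar. *)
  have half a x : sup_seminorm S (a *: x) <= `|a| * sup_seminorm S x.
    apply: sup_seminorm_le => p Sp; have [_ -> _] := SC _ Sp.
    by rewrite ler_wpM2l// sup_seminorm_ge.
  move=> a x; apply/eqP; rewrite eq_le half /=.
  have [->|a0] := eqVneq a 0.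
    have [p Sp] := S0; have [_ pZ _] := SC _ Sp.
    by rewrite normr0 mul0r; apply: le_trans (sup_seminorm_ge _ _ Sp); rewrite pZ normr0 mul0r.
  rewrite -ler_pdivlMl ?normr_gt0// -normfV.
  by apply: le_trans (half _ _); rewrite scalerA mulVf// scale1r.
- by move=> x; apply: sup_seminorm_le => p Sp; have [_ _] := SC _ Sp; exact.
Qed.

Lemma sup_seminorm_mono x y :
  (forall p, S p -> exists2 q, S q & p x <= q y) -> sup_seminorm S x <= sup_seminorm S y.
Proof.
move=> h; apply: sup_seminorm_le => p /h[q Sq /le_trans]; apply; exact: sup_seminorm_ge.
Qed.
End SupSeminorm.

(** * The fundamental function *)

(** Coefficients of modulus at most 1, and not only equal to 1, make this the
fundamental function of the 1-unconditional renorming [U] without having to construct [U]. *)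
Definition phi {R : realType} {X : normedModType R} (e : nat -> X) (n : nat) : R :=
  sup [set `|\sum_(i <- p.1) p.2 i *: e i| | p in
        [set p : {fset nat} * (nat -> R) |
          (#|` p.1| <= n)%N /\ forall i, `|p.2 i| <= 1]].

Section FundamentalFunction.
Context {R : realType} {X : normedModType R} {e : nat -> X} {C : R}.
Hypothesis hC : forall i, `|e i| <= C.
Local Notation phi := (phi e).

Lemma phi_ge n (A : {fset nat}) (a : nat -> R) : (#|` A| <= n)%N ->
  (forall i, `|a i| <= 1) -> `|\sum_(i <- A) a i *: e i| <= phi n.
Proof.
move=> An a1; apply: ub_le_sup; last by exists (A, a).
exists (C *+ n) => _ [[B b]] /= [Bn b1] <-.
have C0 : 0 <= C by apply: le_trans (hC 0%N).
apply: le_trans (ler_norm_sum _ _ _) _.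
apply: (@le_trans _ _ (\sum_(i <- B) C)); last first.
  by rewrite sum_fset_const ler_wpMn2l.
by apply: ler_sum => i _; rewrite normrZ -[C]mul1r ler_pM.
Qed.

Lemma phi_le n t :
  (forall (A : {fset nat}) (a : nat -> R), (#|` A| <= n)%N ->
     (forall i, `|a i| <= 1) -> `|\sum_(i <- A) a i *: e i| <= t) ->
  phi n <= t.
Proof.
move=> h; apply: ge_sup; last by move=> _ [[B b]] /= [Bn b1] <-; exact: h.
eexists; exists ((fset0 : {fset nat}), (fun=> 0)); last reflexivity.
by split=> // i; rewrite normr0.
Qed.

Lemma phi_ge0 n : 0 <= phi n.
Proof.
by apply: le_trans (phi_ge n fset0 (fun=> 0) _ _) => // i; rewrite normr0.
Qed.

Lemma phi0 : phi 0%N = 0.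
Proof.
apply/eqP; rewrite eq_le phi_ge0 andbT; apply: phi_le => A a.
by rewrite leqn0 cardfs_eq0 => /eqP -> _; rewrite big_seq_fset0 normr0.
Qed.

Lemma phi_homo m n : (m <= n)%N -> phi m <= phi n.
Proof. by move=> mn; apply: phi_le => A a Am a1; apply: phi_ge => //; exact: leq_trans mn. Qed.

(** If [s] is a sum over a set of [n.+1] indices, the [n.+1] sums in which one
index is omitted add up to [n *: s], and each of them has norm at most [phi n]. *)
Lemma phi_succ_le n : n%:R * phi n.+1 <= n.+1%:R * phi n.
Proof.
case: n => [|n]; first by rewrite mul0r mulr_ge0// phi_ge0.
rewrite mulrC -ler_pdivlMr ?ltr0n//; apply: phi_le => A a An a1.
rewrite ler_pdivlMr ?ltr0n// mulrC.
have [An'|An'] := leqP #|` A| n.+1.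
  by rewrite ler_pM ?ler_nat//; exact: phi_ge.
have {An An'} An : #|` A| = n.+2 by apply/eqP; rewrite eqn_leq An.
set s := \sum_(i <- A) _.
have -> : n.+1%:R * `|s| = `|\sum_(j <- A) \sum_(i <- (A `\ j)%fset) a i *: e i|.
  rewrite -[n.+1%:R]ger0_norm// -normrZ; congr `|_|.
  rewrite (eq_big_seq (fun j => s - a j *: e j)); last first.
    by move=> j jA; rewrite /s (big_fsetD1 j jA)/= addrAC subrr add0r.
  by rewrite sumrB sum_fset_const An -/s [s *+ n.+2]mulrSr addrK scaler_nat.
apply: le_trans (ler_norm_sum _ _ _) _.
apply: (@le_trans _ _ (\sum_(i <- A) phi n.+1)); last first.
  by rewrite sum_fset_const An mulr_natl.
rewrite big_seq [leRHS]big_seq; apply: ler_sum => i iA; apply: phi_ge => //.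
by have := cardfsD1 i A; rewrite An iA add1n => -[->].
Qed.

Lemma phi_div_antitone m n : (0 < m)%N -> (m <= n)%N -> phi n / n%:R <= phi m / m%:R.
Proof.
move=> m0 /subnK <-; elim: (n - m)%N => [//|k]; apply: le_trans.
have k0 : (0 < k + m)%N by rewrite addn_gt0 m0 orbT.
rewrite addSn ler_pdivrMr ?ltr0n// mulrAC ler_pdivlMr ?ltr0n//.
by rewrite mulrC [leRHS]mulrC phi_succ_le.
Qed.

(** For [n = 0] both sides vanish, so the weight [phi n / n] of an empty set is
harmless. *)
Lemma phi_divK n : phi n / n%:R * n%:R = phi n.
Proof. by case: n => [|n]; [rewrite phi0 !mul0r | rewrite divfK]. Qed.

End FundamentalFunction.

(** * The new norm *)

Section Families.
Context {R : realType} {X : normedModType R}.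
Implicit Types (e : nat -> X) (A E : {fset nat}).

Definition multiplier_seminorm e A (lam : nat -> R) (x : X) : R :=
  `|\sum_(i <- A) (lam i * coord e i x) *: e i|.

Definition average_seminorm e E (x : X) : R :=
  phi e #|` E| / #|` E|%:R * \sum_(i <- E) `|coord e i x|.

Definition multiplier_seminorms e : set (X -> R) :=
  [set p | exists A lam, (forall i, `|lam i| <= 1) /\ p = multiplier_seminorm e A lam].

Definition average_seminorms e : set (X -> R) := range (average_seminorm e).

(** The supremum over this union is the maximum of the suprema over the two
families. *)
Definition all_seminorms e : set (X -> R) := multiplier_seminorms e `|` average_seminorms e.

(** The heavily weighted second term is symmetric, that is, invariant under
permutations of the coordinates; it absorbs the lack of symmetry of the first.
Both suprema have the value [phi #|A|] at the sum of the basis vectors in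
[A]. *)
Definition greedy_norm (e : nat -> X) (delta : R) (x : X) : R :=
  sup_seminorm (all_seminorms e) x + delta^-1 * sup_seminorm (average_seminorms e) x.

End Families.

Section Renorming.
Context {R : realType} {X : normedModType R} {e : nat -> X}.
Hypothesis he : schauder_basis e.
Context {c C K D : R}.
Hypotheses (c0 : 0 < c) (hc : forall i, c <= `|e i|) (hC : forall i, `|e i| <= C).
Hypotheses (K1 : 1 <= K) (hK : K_unconditional (fun x : X => `|x|) e K).
Hypotheses (D1 : 1 <= D) (hD : D_bidemocratic (fun x : X => `|x|) e D).
Local Notation phi := (phi e).
Local Notation B := (K * K * D).

Lemma phi_gt0 n : (0 < n)%N -> 0 < phi n.
Proof.
move=> n0; apply: (lt_le_trans c0); apply: le_trans (hc 0%N) _.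
have := phi_ge hC n [fset 0%N]%fset (fun=> 1) _ _.
by rewrite big_seq_fset1 scale1r cardfs1 normr1; apply.
Qed.

Lemma fsum_uncond (A : {fset nat}) (a : nat -> R) (y : X) :
  (forall i, i \in A -> `|a i| <= `|coord e i y|) ->
  `|\sum_(i <- A) a i *: e i| <= K * `|y|.
Proof.
move=> h; apply: (hK _ _ _ _ (expansion_fsum A a) (expansion_coord he y)) => i.
by case: ifP => [/h//|_]; rewrite normr0.
Qed.

Lemma multiplier_seminorm_le A lam x : (forall i, `|lam i| <= 1) ->
  multiplier_seminorm e A lam x <= K * `|x|.
Proof. by move=> l1; apply: fsum_uncond => i _; rewrite normrM ler_piMl. Qed.

(** Bidemocracy without extended reals: test the two suprema on [A] and on the
normalization of [x]. *)
Lemma bidemocratic_pairing (A E : {fset nat}) n x : (0 < n)%N ->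
  (#|` A| <= n)%N -> (#|` E| <= n)%N ->
  `|\sum_(i <- A) e i| * `|\sum_(i <- E) coord e i x| <= D * n%:R * `|x|.
Proof.
move=> n0 An En.
have [->|x0] := eqVneq x 0.
  rewrite normr0 mulr0 [\sum_(i <- E) _]big1 ?normr0 ?mulr0// => i _.
  by rewrite (coord_zero he).
have x0' : 0 < `|x| by rewrite normr_gt0.
rewrite -ler_pdivrMr// -mulrA -lee_fin; apply: le_trans (hD n n0).
rewrite EFinM; apply: lee_pmul; rewrite ?lee_fin ?divr_ge0 ?mulr_ge0//.
  by apply: ereal_sup_ubound; exists A.
apply: (@le_trans _ _ (dual_norm (fun x : X => `|x|) (fun x => \sum_(i <- E) coord e i x))).
  apply: ereal_sup_ubound; exists (`|x|^-1 *: x).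
    by rewrite /= normrZ normfV normr_id mulVf// gt_eqF.
  rewrite -[in RHS](normr_id x) -normrV; last by rewrite unitfE gt_eqF.
  rewrite -normrM mulr_suml; congr (`|_|%:E).
  by apply: eq_bigr => i _; rewrite (coordZ he) mulrC.
by apply: ereal_sup_ubound; exists E.
Qed.

(** Replace [x] by the vector [y] with coordinates [|x_i|] on [E], so that the sum
of moduli becomes the value at [y] of the functional attached to [E], which
bidemocracy controls.  One factor [K] comes from the passage to [y], the other
from the coefficients [a i] in the definition of [phi]. *)
Lemma average_seminorm_le E x : average_seminorm e E x <= K * K * D * `|x|.
Proof.
have K0 : 0 < K by exact: lt_le_trans K1.
have D0 : 0 < D by exact: lt_le_trans D1.
rewrite /average_seminorm; set s := \sum_(i <- E) _.
have s0 : 0 <= s by exact: sumr_ge0.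
have [En|En] := posnP #|` E|.
  by rewrite En (phi0 hC) !mul0r !mulr_ge0// ltW.
move: s0; rewrite le_eqVlt => /orP[/eqP <-|s0].
  by rewrite mulr0 !mulr_ge0// ltW.
rewrite mulrAC ler_pdivrMr ?ltr0n// -ler_pdivlMr//; apply: phi_le => A a An a1.
rewrite ler_pdivlMr//.
pose y := \sum_(i <- E) `|coord e i x| *: e i.
have yx : `|y| <= K * `|x| by apply: fsum_uncond => i _; rewrite normr_id.
have ys : \sum_(i <- E) coord e i y = s.
  by apply: eq_big_seq => i iE; rewrite (coord_fsum he) iE.
have A1 : `|\sum_(i <- A) a i *: e i| <= K * `|\sum_(i <- A) e i|.
  rewrite -[in leRHS](eq_bigr _ (fun i _ => scale1r (e i))).
  by apply: fsum_uncond => i iA; rewrite (coord_fsum he) iA normr1.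
have := bidemocratic_pairing _ _ _ y En An (leqnn _).
rewrite ys (gtr0_norm s0) => pair.
have -> : K * K * D * `|x| * #|` E|%:R = K * (D * #|` E|%:R * (K * `|x|)) by ring.
apply: le_trans (ler_wpM2r (ltW s0) A1) _; rewrite /= -[leLHS]mulrA ler_pM2l//.
by apply: le_trans pair _; rewrite ler_pM2l// mulr_gt0// ltr0n.
Qed.

(** * Monotonicity and values at sums of basis vectors *)

Lemma multiplier_seminorm_bounded p : multiplier_seminorms e p -> bounded_seminorm B p.
Proof.
move=> [A [lam [l1 ->]]]; split.
- move=> x y; apply: le_trans _ (ler_normD _ _); rewrite -big_split /= /multiplier_seminorm.
  rewrite le_eqVlt; apply/orP; left; apply/eqP; congr `|_|.
  by apply: eq_bigr => i _; rewrite (coordD he) mulrDr scalerDl.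
- move=> a x; rewrite /multiplier_seminorm -normrZ scaler_sumr; congr `|_|.
  by apply: eq_bigr => i _; rewrite (coordZ he) scalerA mulrCA.
- move=> x; apply: le_trans (multiplier_seminorm_le _ _ _ l1) _.
  by rewrite ler_wpM2r// -mulrA ler_peMr ?mulr_ege1// (le_trans _ K1).
Qed.

Lemma average_seminorm_bounded p : average_seminorms e p -> bounded_seminorm B p.
Proof.
move=> [E _ <-].
have W0 : 0 <= phi #|` E| / #|` E|%:R by rewrite divr_ge0// (phi_ge0 hC).
split.
- move=> x y; rewrite /average_seminorm -mulrDr ler_wpM2l// -big_split /=.
  by apply: ler_sum => i _; rewrite (coordD he) ler_normD.
- move=> a x; rewrite /average_seminorm mulrCA [in RHS]mulr_sumr; congr (_ * _).
  by apply: eq_bigr => i _; rewrite (coordZ he) normrM.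
- by move=> x; exact: average_seminorm_le.
Qed.

Lemma all_seminorms_bounded p : all_seminorms e p -> bounded_seminorm B p.
Proof. by move=> [/multiplier_seminorm_bounded|/average_seminorm_bounded]. Qed.

Lemma average_seminorms_neq0 : average_seminorms e !=set0.
Proof. by exists (average_seminorm e fset0), fset0. Qed.

Lemma all_seminorms_neq0 : all_seminorms e !=set0.
Proof. by exists (average_seminorm e fset0); right; exists fset0. Qed.

Lemma seminorm_le_sup p x : all_seminorms e p -> p x <= sup_seminorm (all_seminorms e) x.
Proof. exact: (sup_seminorm_ge all_seminorms_bounded). Qed.

Lemma average_seminorm_le_sup E x : average_seminorm e E x <= sup_seminorm (average_seminorms e) x.
Proof. by apply: (sup_seminorm_ge average_seminorm_bounded); exists E. Qed.

Lemma sup_average_seminorms_mono x y : (forall i, `|coord e i x| <= `|coord e i y|) ->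
  sup_seminorm (average_seminorms e) x <= sup_seminorm (average_seminorms e) y.
Proof.
move=> xy; apply: (sup_seminorm_mono average_seminorms_neq0 average_seminorm_bounded) => _ [E _ <-].
exists (average_seminorm e E); first by exists E.
by rewrite ler_wpM2l ?divr_ge0 ?(phi_ge0 hC)//; apply: ler_sum.
Qed.

(** If [|x_i| <= |y_i|], then multiplying by [lam] at [x] is the same as
multiplying by [lam i * (x_i / y_i)] at [y]. *)
Lemma sup_all_seminorms_mono x y : (forall i, `|coord e i x| <= `|coord e i y|) ->
  sup_seminorm (all_seminorms e) x <= sup_seminorm (all_seminorms e) y.
Proof.
move=> xy; apply: (sup_seminorm_mono all_seminorms_neq0 all_seminorms_bounded) => p.
move=> [[A [lam [l1 ->]]]|[E _ <-]].
- exists (multiplier_seminorm e A (fun i => lam i * (coord e i x / coord e i y))).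
    left; exists A, (fun i => lam i * (coord e i x / coord e i y)); split => // i.
    rewrite normrM mulr_ile1// normrM normfV.
    have [->|y0] := eqVneq (coord e i y) 0; first by rewrite normr0 invr0 mulr0.
    by rewrite ler_pdivrMr ?normr_gt0// mul1r.
  rewrite le_eqVlt; apply/orP; left; apply/eqP; congr `|_|.
  apply: eq_bigr => i _; congr (_ *: _); rewrite -mulrA.
  (* If y_i = 0, then x_i = 0 as well, and the junk value of the quotient is
     irrelevant. *)
  have [y0|y0] := eqVneq (coord e i y) 0; last by rewrite divfK.
  have /eqP -> : coord e i x == 0 by rewrite -normr_le0 (le_trans (xy i))// y0 normr0.
  by rewrite !mul0r.
- exists (average_seminorm e E); first by right; exists E.
  by rewrite ler_wpM2l ?divr_ge0 ?(phi_ge0 hC)//; apply: ler_sum.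
Qed.

Lemma coord_indicator i (A : {fset nat}) : coord e i (\sum_(j <- A) e j) = (i \in A)%:R.
Proof.
rewrite -(eq_bigr _ (fun i _ => scale1r (e i))) (coord_fsum he).
by case: ifP.
Qed.

Lemma sum_indicator (A E : {fset nat}) :
  \sum_(i <- E) (i \in A)%:R = #|` (E `&` A)%fset|%:R :> R.
Proof.
rewrite (eq_bigr (fun i => if i \in A then 1 else 0)); last by move=> i _; case: ifP.
rewrite -big_mkcond /= big_fset_condE sum_fset_const; congr (_ *+ #|` _|).
by apply/fsetP => i; rewrite !inE.
Qed.

(** For an average over [E], only the [k] indices common to [E] and [A] count,
and [phi #|E| / #|E| * k <= phi k / k * k] as [phi n / n] is nonincreasing. *)
Lemma seminorm_indicator_le p (A : {fset nat}) : all_seminorms e p ->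
  p (\sum_(i <- A) e i) <= phi #|` A|.
Proof.
move=> [[E [lam [l1 ->]]]|[E _ <-]].
- have -> : multiplier_seminorm e E lam (\sum_(i <- A) e i) =
      `|\sum_(i <- A) (lam i * (i \in E)%:R) *: e i|.
    (* Both vectors have the coordinates lam i on the intersection of A and E. *)
    rewrite /multiplier_seminorm; congr `|_|; apply: (coord_inj he) => i.
    by rewrite !(coord_fsum he) coord_indicator; do 2!case: ifP; rewrite ?mulr0.
  apply: (phi_ge hC) => // i; rewrite normrM mulr_ile1//.
  by case: (_ \in _); rewrite ?normr1 ?normr0.
- rewrite /average_seminorm (eq_bigr (fun i => (i \in A)%:R)); last first.
    by move=> i _; rewrite coord_indicator ger0_norm.
  rewrite sum_indicator; set k := #|` (E `&` A)%fset|.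
  have [->|k0] := posnP k; first by rewrite mulr0 (phi_ge0 hC).
  apply: (@le_trans _ _ (phi k)).
    rewrite -[leRHS](phi_divK hC) ler_wpM2r// (phi_div_antitone hC)//.
    by rewrite fsubset_leq_card// fsubsetIl.
  by rewrite (phi_homo hC)// fsubset_leq_card// fsubsetIr.
Qed.

(** The multipliers constantly 1 on initial segments give the partial sums of the
expansion of [x]. *)
Lemma norm_le_sup x : `|x| <= sup_seminorm (all_seminorms e) x.
Proof.
have /(@cvg_norm _ _ _ _) := expansion_coord he x.
move/cvgr_to_le; apply; near=> n.
pose A := seq_fset tt (index_iota 0 n).
have -> : `|series (fun i => coord e i x *: e i) n| = multiplier_seminorm e A (fun=> 1) x.
  rewrite /multiplier_seminorm sum_seq_fset ?iota_uniq//; congr `|_|.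
  by apply: eq_bigr => i _; rewrite mul1r.
apply: seminorm_le_sup; left; exists A, (fun=> 1); split => // i.
by rewrite normr1.
Unshelve. all: by end_near. Qed.

(** * Renorming: equivalence, unconditionality and bidemocracy *)

Lemma greedy_norm_equivalent (delta : R) : 0 < delta -> equivalent_norm (greedy_norm e delta).
Proof.
move=> d0.
have [FD FZ FB] := sup_seminorm_bounded all_seminorms_neq0 all_seminorms_bounded.
have [AD AZ AB] := sup_seminorm_bounded average_seminorms_neq0 average_seminorm_bounded.
have di : 0 < delta^-1 by rewrite invr_gt0.
have A0 x : 0 <= sup_seminorm (average_seminorms e) x.
  apply: le_trans (average_seminorm_le_sup fset0 x).
  by rewrite mulr_ge0 ?divr_ge0 ?(phi_ge0 hC)// sumr_ge0.
have lower x : `|x| <= greedy_norm e delta x.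
  by rewrite (le_trans (norm_le_sup x))// lerDl mulr_ge0// ltW.
split; first split.
- move=> x y; rewrite /greedy_norm.
  apply: le_trans (lerD (FD x y) (ler_wpM2l (ltW di) (AD x y))) _.
  by rewrite mulrDr addrACA.
- by move=> a x; rewrite /greedy_norm FZ AZ mulrCA -mulrDr.
- by move=> x x0; apply/eqP; rewrite -normr_le0 -x0.
have B0 : 0 < B by rewrite !mulr_gt0// (lt_le_trans _ K1, lt_le_trans _ D1).
exists 1, ((1 + delta^-1) * B); split => //; first by rewrite mulr_gt0// addr_gt0.
move=> x; rewrite mul1r lower /= /greedy_norm -(mulrA _ B) mulrDl mul1r lerD//.
by rewrite ler_pM2l.
Qed.

Lemma greedy_norm_unconditional (delta : R) : 0 < delta ->
  K_unconditional (greedy_norm e delta) e 1.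
Proof.
move=> d0 a b x y hx hy ab.
have xy i : `|coord e i x| <= `|coord e i y|.
  by rewrite (coord_expansion he _ _ hx) (coord_expansion he _ _ hy).
rewrite mul1r /greedy_norm lerD ?sup_all_seminorms_mono//.
by rewrite ler_wpM2l ?sup_average_seminorms_mono// invr_ge0 ltW.
Qed.

(** The average over [A] is one of the defining seminorms of both terms of the
norm, which bounds the dual norm of [\sum_(i <- A) e_i^*] from above by exactly
what the bound on the fundamental function requires. *)
Lemma greedy_norm_bidemocratic (delta : R) : 0 < delta ->
  D_bidemocratic (greedy_norm e delta) e 1.
Proof.
move=> d0 n n0; set N := greedy_norm e delta.
have K0 : 0 < 1 + delta^-1 by rewrite addr_gt0// invr_gt0.
have P0 : 0 < (1 + delta^-1) * phi n by rewrite mulr_gt0// phi_gt0.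
have indicator (A : {fset nat}) : (#|` A| <= n)%N ->
    N (\sum_(i <- A) e i) <= (1 + delta^-1) * phi n.
  move=> An; rewrite /N /greedy_norm mulrDl mul1r lerD//.
    apply: (sup_seminorm_le all_seminorms_neq0) => p Fp.
    apply: le_trans (seminorm_indicator_le _ _ Fp) _.
    exact: phi_homo hC _ _ An.
  rewrite ler_pM2l ?invr_gt0//; apply: (sup_seminorm_le average_seminorms_neq0) => p Ap.
  by apply: le_trans (seminorm_indicator_le _ A (or_intror Ap)) _; exact: phi_homo hC _ _ An.
have dual (A : {fset nat}) x : (#|` A| <= n)%N -> N x <= 1 ->
    `|\sum_(i <- A) coord e i x| <= n%:R / ((1 + delta^-1) * phi n).
  move=> An Nx; have [A0|A0] := posnP #|` A|.
    rewrite (cardfs0_eq A0) big_seq_fset0 normr0 divr_ge0// ltW//.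
  apply: le_trans (ler_norm_sum _ _ _) _; set s := \sum_(i <- A) _.
  rewrite ler_pdivlMr// mulrC.
  have : (1 + delta^-1) * average_seminorm e A x <= 1.
    apply: le_trans Nx; rewrite /N /greedy_norm mulrDl mul1r lerD//.
      by apply: seminorm_le_sup; right; exists A.
    by rewrite ler_pM2l ?invr_gt0// average_seminorm_le_sup.
  apply: contraLR; rewrite -!ltNge => h.
  rewrite /average_seminorm -/s.
  have s0 : 0 <= s by exact: sumr_ge0.
  apply: (@lt_le_trans _ _ ((1 + delta^-1) * (phi n / n%:R * s))).
    by rewrite mulrA mulrA mulrAC ltr_pdivlMr ?ltr0n// mul1r.
  by rewrite ler_pM2l// ler_wpM2r// (phi_div_antitone hC).
have -> : 1 * n%:R = (1 + delta^-1) * phi n * (n%:R / ((1 + delta^-1) * phi n)).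
  by rewrite mul1r mulrC divfK// gt_eqF.
have N0 : N 0 = 0.
  have [_ NZ _] := (greedy_norm_equivalent _ d0).1.
  by rewrite /N -[in LHS](scale0r (0 : X)) NZ normr0 mul0r.
rewrite EFinM; apply: lee_pmul.
(* The empty set and the zero vector witness that both suprema are nonnegative. *)
- apply: ereal_sup_ubound; exists fset0 => //=.
  by rewrite big_seq_fset0 N0.
- apply: (@le_trans _ _ (dual_norm N (fun x => \sum_(i <- fset0) coord e i x))).
    by apply: ereal_sup_ubound; exists 0; rewrite /= ?N0// big_seq_fset0 normr0.
  by apply: ereal_sup_ubound; exists fset0.
- by apply: ge_ereal_sup => _ [A An <-]; rewrite lee_fin indicator.
- apply: ge_ereal_sup => _ [A An <-]; apply: ge_ereal_sup => _ [x Nx <-].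
  by rewrite lee_fin dual.
Qed.

(** * Renorming: greediness *)

(** The setting of the greedy inequality: [G] is a set of largest coordinates of
[x], separated from the others by the threshold [t], and [y] is what remains of
[x] after an arbitrary approximation supported in a set [A] no larger than [G]. *)
Section Greedy.
Context {x : X} {a : nat -> R} {t : R} {G A : {fset nat}}.
Hypotheses (t0 : 0 <= t) (AG : (#|` A| <= #|` G|)%N).
Hypotheses (Glarge : forall i, i \in G -> t <= `|coord e i x|).
Hypotheses (Gsmall : forall i, i \notin G -> `|coord e i x| <= t).
Let x' := x - \sum_(i <- G) coord e i x *: e i.
Let y := x - \sum_(i <- A) a i *: e i.

Lemma coord_residual i : coord e i x' = if i \in G then 0 else coord e i x.
Proof. by rewrite (coordB he) (coord_fsum he); case: ifP; rewrite ?subrr ?subr0. Qed.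

Lemma coord_competitor i : i \notin A -> coord e i y = coord e i x.
Proof. by move=> iA; rewrite (coordB he) (coord_fsum he) (negbTE iA) subr0. Qed.

(** Given a set [E] on which to test [x'], drop its indices in [G], where [x']
vanishes, and exchange those in [A] for as many indices in [G \ A].  On the
resulting set [E'] the coordinates of [y] are those of [x], and the exchanged ones
have passed from at most [t] to at least [t]. *)
Lemma sup_average_seminorms_greedy :
  sup_seminorm (average_seminorms e) x' <= sup_seminorm (average_seminorms e) y.
Proof.
apply: (sup_seminorm_le average_seminorms_neq0) => _ [E _ <-].
pose P := ((E `\` G) `&` A)%fset; pose Q := ((E `\` G) `\` A)%fset.
have [P' sP' cP'] : exists2 P' : {fset nat}, (P' `<=` G `\` A)%fset & #|` P'| = #|` P|.
  apply: exists_subset_card; apply: leq_trans (card_fsetD_exchange AG).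
  apply: fsubset_leq_card; apply/fsubsetP => i; rewrite !inE.
  by move=> /andP[/andP[-> _] ->].
have dis : [disjoint Q & P']%fset.
  apply/fdisjointP => i; rewrite !inE => /andP[_ /andP[iG _]].
  by apply/negP => /(fsubsetP sP'); rewrite !inE (negbTE iG) andbF.
pose E' := (Q `|` P')%fset.
have cE' : #|` E'| = #|` (E `\` G)%fset|.
  by rewrite cardfsU (disjoint_fsetI0 dis) cardfs0 subn0 cP' addnC cardfsID.
apply: le_trans (average_seminorm_le_sup E' y); rewrite /average_seminorm.
have -> : \sum_(i <- E) `|coord e i x'| = \sum_(i <- (E `\` G)%fset) `|coord e i x|.
  rewrite (sum_fsetID E G) big_seq big1 ?add0r; last first.
    by move=> i; rewrite inE => /andP[_ iG]; rewrite coord_residual iG normr0.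
  by apply: eq_big_seq => i; rewrite inE coord_residual => /andP[/negbTE ->].
have sums : \sum_(i <- (E `\` G)%fset) `|coord e i x| <= \sum_(i <- E') `|coord e i y|.
  rewrite (sum_fsetID _ A) (sum_fsetU _ _ _ dis) addrC lerD//.
    rewrite big_seq [leRHS]big_seq ler_sum// => i.
    by rewrite inE => /andP[iA _]; rewrite coord_competitor.
  apply: (@le_trans _ _ (\sum_(i <- P) t)).
    rewrite big_seq [leRHS]big_seq ler_sum// => i.
    by rewrite !inE => /andP[/andP[iG _] _]; exact: Gsmall.
  rewrite sum_fset_const -cP' -sum_fset_const.
  rewrite big_seq [leRHS]big_seq ler_sum// => i /(fsubsetP sP').
  by rewrite inE => /andP[iA iG]; rewrite coord_competitor// Glarge.
(* The monotonicity of phi n / n needs a nonempty set. *)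
have [D0|D0] := posnP #|` (E `\` G)%fset|.
  rewrite (cardfs0_eq D0) big_seq_fset0 mulr0 mulr_ge0 ?divr_ge0 ?(phi_ge0 hC)//.
  exact: sumr_ge0.
rewrite cE' ler_pM ?divr_ge0 ?(phi_ge0 hC)//; first exact: sumr_ge0.
by rewrite (phi_div_antitone hC)// fsubset_leq_card// fsubsetDl.
Qed.

(** Split [x'] into [x' - v], dominated by [y] coordinatewise, and its part [v] in
[A \ G], whose coordinates are at most [t].  The second costs at most
[t * phi #|A \ G|],
and the average of [y] over [G \ A] is at least [t * phi #|G \ A|]. *)
Lemma sup_all_seminorms_greedy : sup_seminorm (all_seminorms e) x' <=
  sup_seminorm (all_seminorms e) y + sup_seminorm (average_seminorms e) y.
Proof.
have [FD FZ _] := sup_seminorm_bounded all_seminorms_neq0 all_seminorms_bounded.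
pose v := \sum_(i <- (A `\` G)%fset) coord e i x *: e i.
rewrite -[x'](subrK v); apply: le_trans (FD _ _) _; apply: lerD.
  apply: sup_all_seminorms_mono => i; rewrite (coordB he) (coord_fsum he) coord_residual inE.
  have [iG|iG] := boolP (i \in G); first by rewrite subr0 normr0.
  have [iA|iA] := boolP (i \in A); first by rewrite subrr normr0.
  by rewrite subr0 coord_competitor.
apply: (@le_trans _ _ (sup_seminorm (all_seminorms e) (t *: \sum_(i <- (A `\` G)%fset) e i))).
  apply: sup_all_seminorms_mono => i; rewrite (coordZ he) coord_indicator (coord_fsum he) inE.
  case: ifP => [/andP[iG _]|_]; last by rewrite mulr0.
  by rewrite mulr1 (ger0_norm t0) Gsmall.
rewrite FZ (ger0_norm t0); apply: le_trans (average_seminorm_le_sup (G `\` A)%fset y).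
apply: (@le_trans _ _ (t * phi #|` (G `\` A)%fset|)).
  apply: ler_wpM2l => //; apply: (sup_seminorm_le all_seminorms_neq0) => p Fp.
  by apply: le_trans (seminorm_indicator_le _ _ Fp) _; exact: (phi_homo hC _ _ (card_fsetD_exchange AG)).
rewrite /average_seminorm -[in leLHS](phi_divK hC) [leLHS]mulrC -[leLHS]mulrA.
rewrite ler_wpM2l ?divr_ge0 ?(phi_ge0 hC)//.
rewrite mulr_natl -sum_fset_const big_seq [leRHS]big_seq ler_sum// => i.
by rewrite inE => /andP[iA iG]; rewrite coord_competitor// Glarge.
Qed.

Lemma greedy_norm_exchange (delta : R) : 0 < delta ->
  greedy_norm e delta x' <= (1 + delta) * greedy_norm e delta y.
Proof.
move=> d0; rewrite /greedy_norm.
have [_ _ FB] := sup_seminorm_bounded all_seminorms_neq0 all_seminorms_bounded.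
have F0 : 0 <= sup_seminorm (all_seminorms e) y by exact: le_trans (norm_le_sup y).
apply: le_trans (lerD sup_all_seminorms_greedy (ler_wpM2l _ sup_average_seminorms_greedy)) _.
  by rewrite invr_ge0 ltW.
rewrite mulrDl mul1r mulrDr mulrA divff ?gt_eqF// mul1r.
by rewrite [leLHS]addrAC lerD2l lerDr mulr_ge0// ltW.
Qed.
End Greedy.

(** The threshold is the modulus of the last coordinate selected by the greedy
ordering. *)
Lemma greedy_norm_greedy (delta : R) (rho : X -> nat -> nat) : 0 < delta ->
  (forall x, greedy_ordering e x (rho x)) ->
  C_greedy (greedy_norm e delta) e rho (1 + delta).
Proof.
move=> d0 hrho x [//|m] _; have [rinj rdec rout] := hrho x.
set r := rho x in rinj rdec rout *.
have d1 : 0 < 1 + delta by rewrite addr_gt0.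
have uG : uniq (map r (iota 0 m.+1)) by rewrite map_inj_uniq ?iota_uniq.
pose G := seq_fset tt (map r (iota 0 m.+1)).
have -> : greedy_approximant e r m.+1 x = \sum_(i <- G) coord e i x *: e i.
  rewrite sum_seq_fset// big_map /greedy_approximant.
  by rewrite -(big_mkord xpredT (fun k => coord e (r k) x *: e (r k))) /index_iota subn0.
rewrite mulrC -ler_pdivrMr//; apply: lb_le_inf.
  by exists (greedy_norm e delta (x - \sum_(i <- fset0) 0 *: e i)), fset0, (fun=> 0).
move=> _ [A [a [Am ->]]]; rewrite ler_pdivrMr// mulrC.
have anti j k : (j <= k)%N -> `|coord e (r k) x| <= `|coord e (r j) x|.
  by move=> /subnK <-; elim: (k - j)%N => [//|i]; apply: le_trans; exact: rdec.
apply: (@greedy_norm_exchange _ _ `|coord e (r m) x|) => //.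
- by rewrite size_seq_fset undup_id// size_map size_iota.
- by move=> i; rewrite seq_fsetE => /mapP[k]; rewrite mem_iota add0n => km ->; exact: anti.
- move=> i; rewrite seq_fsetE => /mapP iG; apply: rout => k km ik.
  by apply: iG; exists k => //; rewrite mem_iota.
Qed.

End Renorming.

Theorem theorem1 (R : realType) (X : completeNormedModType R) (e : nat -> X)
  (he : schauder_basis e)
  (hsemi : seminormalized (fun x : X => `|x|) e)
  (hunc : unconditional (fun x : X => `|x|) e)
  (hbid : bidemocratic (fun x : X => `|x|) e)
  (eps : R) (heps : 0 < eps) :
  exists N : X -> R,
    [/\ equivalent_norm N,
        K_unconditional N e 1,
        D_bidemocratic N e 1 &
        forall rho : X -> nat -> nat,
          (forall x, greedy_ordering e x (rho x)) ->
          C_greedy N e rho (1 + eps)].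
Proof.
have [c [C [c0 hcC]]] := hsemi.
have [K0 hK0] := hunc.
have [D [D1 hD]] := hbid.
have hc i : c <= `|e i| by case: (hcC i).
have hC i : `|e i| <= C by case: (hcC i).
pose K := Num.max K0 1.
have K1 : 1 <= K by rewrite le_max lexx orbT.
have hK : K_unconditional (fun x : X => `|x|) e K.
  move=> a b x y hx hy ab; apply: le_trans (hK0 a b x y hx hy ab) _.
  by rewrite ler_wpM2r// le_max lexx.
exists (greedy_norm e eps); split.
- exact: (greedy_norm_equivalent he hC K1 hK D1 hD).
- exact: (greedy_norm_unconditional he hC K1 hK D1 hD).
- exact: (greedy_norm_bidemocratic he c0 hc hC K1 hK D1 hD).
- by move=> rho hrho; exact: (greedy_norm_greedy he hC K1 hK D1 hD eps rho heps hrho).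
Qed.
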